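(* Let $\Delta=[n]$ and let $\Omega\subseteq\mathscr P(\Delta)$ be an upper-closed set system such that $|T|\ge 2$ for every $T\in m(\widehat{\overline\Omega})$. Let $T\in m(\widehat{\overline\Omega})$. Then the covering inequality $\sum_{i\in T}x_i\ge 1$ is facet-defining for $\operatorname{conv}(\mathcal X_\Omega)$ if and only if $\Delta\setminus T\in M(\overline\Omega)$ is quasi-feasible.
   Context: A set system is a subset of the power set $\mathscr P(\Delta)$. $\Omega$ is upper-closed if $T\in\Omega$ and $T\subseteq T'\subseteq\Delta$ imply $T'\in\Omega$. $\overline\Omega:=\mathscr P(\Delta)\setminus\Omega$; $\widehat\Omega:=\{\Delta\setminus T\mid T\in\Omega\}$; $m(\Omega)$ and $M(\Omega)$ are the families of inclusion-minimal and inclusion-maximal members of $\Omega$. $\mathcal X_\Omega\subseteq\{0,1\}^n$ is the set of indicator vectors $x_T$ of the members $T\in\Omega$; since $\Omega$ is upper-closed, it equals $\{x\in\{0,1\}^n\mid\sum_{i\in T}x_i\ge1\ \forall T\in m(\widehat{\overline\Omega})\}$. A set $S\in\overline\Omega$ is quasi-feasible if for every $a\in S$ there exists $a'\in\Delta\setminus S$ such that $(S\setminus\{a\})\cup\{a'\}\in\Omega$. *)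

(* Defs.v *)
From HB Require Import structures.
From mathcomp Require Import all_boot all_order all_algebra.
From mathcomp Require Import mathcomp_extra boolp classical_sets convex.

Set Implicit Arguments.
Unset Strict Implicit.
Unset Printing Implicit Defensive.

Import Order.TTheory GRing.Theory Num.Theory.

Local Open Scope ring_scope.

Section SetSystems.
Variable n : nat.
Implicit Types (Omega : {set {set 'I_n}}) (S T : {set 'I_n}).

Definition upper_closed Omega :=
  forall T T', T \in Omega -> T \subset T' -> T' \in Omega.

Definition hat_sys Omega : {set {set 'I_n}} := [set ~: T | T in Omega]%SET.

Definition min_sets Omega : {set {set 'I_n}} :=
  [set T | minset (fun A => A \in Omega) T]%SET.

Definition max_sets Omega : {set {set 'I_n}} :=
  [set T | maxset (fun A => A \in Omega) T]%SET.

Definition quasi_feasible Omega S :=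
  S \in ~: Omega /\
  forall a, a \in S -> exists2 a', a' \in ~: S & (S :\ a) :|: [set a']%SET \in Omega.

End SetSystems.

Section Polyhedral.
Variables (R : realFieldType) (V : vectType R).
Implicit Types (P : set V) (s : seq V).

Definition convex_hull P : set V := smallest (@convex_set R V) P.

Definition aff_indep s : bool :=
  if s is x0 :: s' then free [seq x - x0 | x <- s'] else true.

(* d is the largest number of affinely independent points of P, minus 1;
   in particular the empty set has dimension -1. *)
Definition has_affdim P (d : int) :=
  (exists s, [/\ forall x, x \in s -> P x, aff_indep s & (size s)%:Z = d + 1]) /\
  (forall s, (forall x, x \in s -> P x) -> aff_indep s -> (size s)%:Z <= d + 1).

(* The inequality in question is b <= f x. *)
Definition facet_defining P (f : {scalar V}) (b : R) :=
  (forall x, P x -> b <= f x) /\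
  exists d : int, has_affdim P d /\
    has_affdim (P `&` [set x | f x = b])%classic (d - 1).

End Polyhedral.

Section Covering.
Variables (R : realFieldType) (n : nat).
Implicit Types (T : {set 'I_n}) (Omega : {set {set 'I_n}}).

Definition indicator_vec T : 'rV[R]_n := \row_i (i \in T)%:R.

Definition indicator_pts Omega : set 'rV[R]_n :=
  [set indicator_vec T | T in [set` Omega]]%classic.

Definition coord_sum T (x : 'rV[R]_n) : R := \sum_(i in T) x 0 i.

Fact coord_sum_is_linear T : scalar (coord_sum T).
Proof.
move=> a x y; rewrite /coord_sum mulr_sumr -big_split /=.
by apply: eq_bigr => i _; rewrite !mxE.
Qed.

HB.instance Definition _ T :=
  GRing.isLinear.Build R 'rV[R]_n R *%R (coord_sum T) (coord_sum_is_linear T).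

End Covering.

Arguments indicator_vec R {n} T.
Arguments indicator_pts R {n} Omega.

(* Main.v *)
Require Import Defs.
From mathcomp Require Import boolp classical_sets convex interval_inference.
From mathcomp Require Import all_boot all_order all_algebra.
From mathcomp Require Import zify lra.

Set Implicit Arguments.
Unset Strict Implicit.
Unset Printing Implicit Defensive.

Import Order.TTheory GRing.Theory Num.Theory.

Local Open Scope ring_scope.

(** Call a set feasible when it belongs to [Omega], and blocking when its
complement is infeasible. Write [S := ~: T], a maximal infeasible set, and
[f x := \sum_(i in T) x_i]. Since every minimal blocking set has at least two
elements, all sets [set~ i] are feasible ([setC1_feasible]), so the hull of the
indicator vectors contains the all-ones vector and its [n] neighbours: it is
full-dimensional ([hull_full_dim]). A feasible set is not contained in [S], so
[1 <= f x] is valid ([coord_sum_valid]). As the hyperplane [f = 1] avoids the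
origin, affine independence on it is linear independence, so the inequality
defines a facet exactly when the face [f = 1] contains a basis of the whole
space ([facet_fullP]).

If [S] is quasi-feasible, such a basis is given by the [n] indicator vectors of
[b |: S] for [b] in [T], feasible by maximality of [S], and of a feasible
exchange [(S :\ a) :|: [set a']] for each [a] in [S]; the vector of
[a' |: S] minus that of the exchange is the [a]-th unit vector, and the unit
vectors indexed by [T] follow ([quasi_feasible_basis]).

Conversely, suppose that some [a] in [S] admits no exchange. Then every feasible
set that meets [T] only once contains [a], so [2 <= f x + x_a] holds at
all vertices, hence on the whole hull, as does [x_a <= 1]. On the face [f = 1]
this forces [x_a = 1 = f x], so [f - x_a] is a nonzero linear form that vanishes
on the face, which therefore contains no basis ([facet_quasi_feasible]). *)

(** * Affine dimension and facets *)

Section Polyhedra.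
Variables (R : realFieldType) (V : vectType R).
Implicit Types (P : set V) (f : {scalar V}) (X s : seq V).

Lemma scalar_span0 f X :
  {in X, forall x, f x = 0} -> {in <<X>>%VS, forall x, f x = 0}.
Proof.
move=> f0 x xX; rewrite [x](@coord_span _ _ _ (in_tuple X)) // linear_sum /=.
by rewrite big1 // => i _; rewrite linearZ /= f0 ?mulr0 // mem_nth.
Qed.

Lemma basis_fullP X :
  reflect ((forall x, x \in <<X>>%VS) /\ (size X <= dim V)%N)
          (basis_of fullv X).
Proof.
rewrite basisEdim dimvf; apply: (iffP andP) => -[sX ->]; split => //.
  by move=> x; apply: (subvP sX); rewrite memvf.
by apply/subvP => x _; apply: sX.
Qed.

(** Let [x0] be the first point. The differences [x - x0] span, together with
[x0], the same space as the points themselves; and [x0] is independent of them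
because [f] kills the differences but not [x0]. *)
Lemma aff_indep_free f s :
  {in s, forall x, f x = 1} -> aff_indep s = free s.
Proof.
case: s => [|x0 s] f1 /=; first by rewrite nil_free.
set ds := [seq x - x0 | x <- s].
have fx0 : f x0 = 1 by rewrite f1 // mem_head.
have x0ds : x0 \notin <<ds>>%VS.
  apply/negP => x0ds; suff: f x0 = 0 by move/eqP; rewrite fx0 oner_eq0.
  apply: scalar_span0 x0ds => _ /mapP[x xs ->].
  by rewrite linearB /= fx0 f1 ?subrr // in_cons xs orbT.
have sub_span X x : x0 \in <<X>>%VS -> (x \in <<X>>%VS) = (x - x0 \in <<X>>%VS).
  by move=> x0X; rewrite rpredBr.
have eq_span_ds : <<x0 :: ds>>%VS = <<x0 :: s>>%VS.
  have head X : x0 \in <<x0 :: X>>%VS by rewrite memv_span ?mem_head.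
  apply/eqP; rewrite eqEsubv; apply/andP; split; apply/span_subvP => x;
    rewrite in_cons => /predU1P[-> //|].
    case/mapP => y ys ->; rewrite -sub_span //.
    by rewrite memv_span // in_cons ys orbT.
  move=> xs; rewrite sub_span //; apply: memv_span.
  by rewrite in_cons; apply/orP; right; apply/mapP; exists x.
transitivity (free (x0 :: ds)); first by rewrite free_cons x0ds.
by rewrite /free eq_span_ds /= size_map.
Qed.

Lemma size_free X : free X -> (size X <= dim V)%N.
Proof. by move/eqnP <-; rewrite -dimvf dimvS ?subvf. Qed.

Lemma size_aff_indep s : aff_indep s -> (size s <= (dim V).+1)%N.
Proof. by case: s => //= x s /size_free; rewrite size_map. Qed.

Lemma has_affdim_unique P d1 d2 : has_affdim P d1 -> has_affdim P d2 -> d1 = d2.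
Proof.
move=> [[s1 [P1 a1 z1]] m1] [[s2 [P2 a2 z2]] m2].
by move: (m1 _ P2 a2) (m2 _ P1 a1); lia.
Qed.

Lemma has_affdim_full P s :
  (forall x, x \in s -> P x) -> aff_indep s -> size s = (dim V).+1 ->
  has_affdim P (dim V)%:Z.
Proof.
move=> sP sA sz; split; first by exists s; split => //; lia.
by move=> t _ /size_aff_indep; lia.
Qed.

(** By [aff_indep_free], affinely independent families in the hyperplane [f = 1]
are linearly independent, hence have at most [dim V] members, with equality only
for bases. *)
Lemma has_affdim_hyperplane f P :
  (forall x, P x -> f x = 1) ->
  has_affdim P ((dim V)%:Z - 1) <->
  exists2 X, forall x, x \in X -> P x & basis_of fullv X.
Proof.
move=> f1; have free_in X : (forall x, x \in X -> P x) -> aff_indep X = free X.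
  by move=> XP; apply: (@aff_indep_free f) => x /XP/f1.
split=> [[[X [XP Xa Xz]] _]|[X XP Xb]].
  exists X => //; rewrite basisEfree -free_in // Xa subvf dimvf /=.
  by move: Xz; rewrite subrK => -[->].
have Xf := basis_free Xb; rewrite /has_affdim subrK; split.
  exists X; rewrite free_in //; split=> //.
  by rewrite -(eqnP Xf) (span_basis Xb) dimvf.
by move=> Y YP; rewrite free_in // => /size_free.
Qed.

(** For a full-dimensional [P] the facet condition loses its quantifier over the
dimension, which must be [dim V]. *)
Lemma facet_fullP f P : has_affdim P (dim V)%:Z ->
  facet_defining P f 1 <->
  (forall x, P x -> 1 <= f x) /\
  exists2 X, forall x, x \in X -> P x /\ f x = 1 & basis_of fullv X.
Proof.
move=> Pd.
have face := @has_affdim_hyperplane f (P `&` [set x | f x = 1])%classic.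
split=> -[valid].
  case=> d [/(has_affdim_unique Pd)<- /face Xf]; split=> //.
  by apply: Xf => x [].
by move=> Xb; split=> //; exists (dim V)%:Z; split=> //; apply/face => // x [].
Qed.

(** Closed half-spaces are convex, so a linear inequality valid at the generators
is valid on their hull, without writing points as convex combinations. *)
Lemma convex_hull_ge f P (b : R) :
  (forall x, P x -> b <= f x) -> forall x, convex_hull P x -> b <= f x.
Proof.
move=> fP; apply: (@smallest_sub _ _ _ [set x | b <= f x]%classic) => //.
move=> x y k /set_mem /= bx /set_mem /= b_le_y; apply: mem_set => /=.
rewrite /conv /= linearD !linearZ /=.
have k0 : 0 <= k%:inum by [].
have k1 : k%:inum <= 1 by [].
rewrite /unstable.onem; nra.
Qed.

Lemma convex_hull_le f P (b : R) :
  (forall x, P x -> f x <= b) -> forall x, convex_hull P x -> f x <= b.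
Proof.
move=> fP x xP; rewrite -lerN2.
by apply: (@convex_hull_ge (\- f)) xP => y /fP; rewrite /= lerN2.
Qed.

End Polyhedra.

(** * Infeasible sets and blocking sets *)

Section SetSystems.
Variables (n : nat) (Omega : {set {set 'I_n}}).
Implicit Types (T U : {set 'I_n}).

Lemma max_sets_infeasible T : T \in max_sets (~: Omega) -> T \notin Omega.
Proof. by rewrite inE => /maxsetp; rewrite inE. Qed.

Lemma min_hat_max T : T \in min_sets (hat_sys (~: Omega)) ->
  ~: T \in max_sets (~: Omega).
Proof.
rewrite !inE maxminset setCK => /minsetP[/imsetP[U UO ->] minU].
apply/minsetP; rewrite /= setCK; split=> // B BO; apply: minU.
by rewrite -[B]setCK imset_f.
Qed.

(** Were [set~ i] infeasible, its complement would be a blocking singleton, and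
would contain a minimal blocking set, with at most one element. *)
Lemma setC1_feasible :
  (forall T, T \in min_sets (hat_sys (~: Omega)) -> (2 <= #|T|)%N) ->
  forall i, [set~ i] \in Omega.
Proof.
move=> large i; apply/negPn/negP => iO.
have : [set i] \in hat_sys (~: Omega).
  by rewrite -[[set i]]setCK imset_f // inE.
case/(@minset_exists _ (mem (hat_sys (~: Omega)))) => A minA /subset_leq_card.
by rewrite cards1 leqNgt large // inE.
Qed.

Lemma max_infeasible_setU1 T b : ~: T \in max_sets (~: Omega) -> b \in T ->
  b |: ~: T \in Omega.
Proof.
rewrite inE => /maxsetsup maxS bT; apply/negPn/negP => bO.
have := maxS (b |: ~: T); rewrite inE bO subsetU1 => /(_ isT isT)/setP/(_ b).
by rewrite !inE eqxx bT.
Qed.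

Lemma feasible_meets T U : upper_closed Omega -> ~: T \notin Omega ->
  U \in Omega -> (0 < #|T :&: U|)%N.
Proof.
move=> upO SO UO; rewrite lt0n cards_eq0; apply: contra SO => TU0.
by apply: upO UO _; rewrite -disjoints_subset -setI_eq0 setIC.
Qed.

End SetSystems.

Section IndicatorVectors.
Variables (R : realFieldType) (n : nat).
Implicit Types (T U : {set 'I_n}) (X : seq 'rV[R]_n) (Omega : {set {set 'I_n}}).

Lemma indicator_hull Omega U : U \in Omega ->
  convex_hull (indicator_pts R Omega) (indicator_vec R U).
Proof. by move=> UO; apply: sub_gen_smallest; exists U. Qed.

Lemma coord_sum_indicator T U :
  coord_sum T (indicator_vec R U) = #|T :&: U|%:R.
Proof.
rewrite /coord_sum -sum1_card natr_sum.
rewrite (eq_bigl _ _ (fun i => in_setI i T U)) big_mkcondr.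
by apply: eq_bigr => i _; rewrite mxE; case: (i \in U).
Qed.

Lemma indicatorD1 U i : i \in U ->
  indicator_vec R (U :\ i) = indicator_vec R U - delta_mx 0 i.
Proof.
move=> iU; apply/rowP => j; rewrite !mxE !inE.
by case: eqP => [->|_]; rewrite ?iU ?subrr ?subr0.
Qed.

Lemma indicator_sum U : indicator_vec R U = \sum_(i in U) delta_mx 0 i.
Proof.
rewrite [LHS]row_sum_delta [RHS]big_mkcond; apply: eq_bigr => i _.
by rewrite mxE; case: (i \in U); rewrite ?scale1r ?scale0r.
Qed.

Lemma delta_basis X :
  (forall i, delta_mx 0 i \in <<X>>%VS) -> (size X <= n)%N -> basis_of fullv X.
Proof.
move=> Xd Xn; apply/basis_fullP; rewrite dim_matrix mul1r; split=> // x.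
by rewrite [x]row_sum_delta rpred_sum // => i _; rewrite rpredZ.
Qed.

(** The all-ones vector and the vectors obtained from it by zeroing one
coordinate are [n.+1] affinely independent points: subtracting the first from
the others gives the opposites of the unit vectors. *)
Lemma hull_full_dim Omega : upper_closed Omega ->
  (forall i, [set~ i] \in Omega) -> (0 < n)%N ->
  has_affdim (convex_hull (indicator_pts R Omega)) (dim 'rV[R]_n)%:Z.
Proof.
move=> upO C1O n_gt0.
pose one := indicator_vec R [set: 'I_n].
pose s := [seq indicator_vec R [set~ i] | i <- enum 'I_n].
have sE i : indicator_vec R [set~ i] - one = - delta_mx 0 i.
  by rewrite -setTD indicatorD1 ?inE // addrAC subrr add0r.
apply: (@has_affdim_full _ _ _ (one :: s)).
- move=> x; rewrite in_cons => /predU1P[->|/mapP[i _ ->]];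
    apply: indicator_hull => //.
  by apply: (upO _ _ (C1O (Ordinal n_gt0))); rewrite subsetT.
- apply: (@basis_free _ _ fullv); apply: delta_basis; last first.
    by rewrite 2!size_map size_enum_ord.
  move=> i; rewrite -[delta_mx 0 i]opprK rpredN -sE memv_span //.
  by rewrite -map_comp; apply/mapP; exists i; rewrite ?mem_enum.
by rewrite /= size_map size_enum_ord dim_matrix mul1r.
Qed.

End IndicatorVectors.

(** * Facets and quasi-feasibility *)

Section Facet.
Variables (R : realFieldType) (n : nat).
Variables (Omega : {set {set 'I_n}}) (T : {set 'I_n}).

Let hull := convex_hull (indicator_pts R Omega).

Lemma coord_sum_valid : upper_closed Omega -> ~: T \notin Omega ->
  forall x, hull x -> 1 <= coord_sum T x.
Proof.
move=> upO SO; apply: convex_hull_ge => _ [U UO <-].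
rewrite /= coord_sum_indicator ler1n.
exact: feasible_meets upO SO UO.
Qed.

(** Every [i] in [T] contributes the vector of [i |: ~: T], and every [i] outside
[T] that of its exchange [(b |: ~: T) :\ i]; together they span all unit
vectors. *)
Lemma quasi_feasible_basis :
  ~: T \in max_sets (~: Omega) -> quasi_feasible Omega (~: T) ->
  exists2 X, forall x, x \in X -> hull x /\ coord_sum T x = 1 & basis_of fullv X.
Proof.
move=> maxS [_ qf].
have swap i : exists U, [/\ U \in Omega, #|T :&: U| = 1%N,
    i \in T -> U = i |: ~: T &
    i \notin T -> exists2 b, b \in T & U = (b |: ~: T) :\ i].
  have [iT|iT] := boolP (i \in T).
    exists (i |: ~: T); split=> //; first exact: max_infeasible_setU1.
    by rewrite setIUr setICr setU0 (setIidPr _) ?cards1 // sub1set.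
  have [|b] := qf i; first by rewrite inE.
  rewrite setCK => bT UO; exists (~: T :\ i :|: [set b]); split=> //.
    rewrite setIUr setIDA setICr set0D set0U.
    by rewrite (setIidPr _) ?cards1 // sub1set.
  exists b => //; rewrite setDUl setUC; congr (_ :|: _); apply/esym/setDidPl.
  by rewrite disjoints1 inE; apply: contraNneq iT => <-.
have [U UP] := fin_all_exists swap.
pose v i := indicator_vec R (U i); pose X := [seq v i | i <- enum 'I_n].
exists X.
  move=> _ /mapP[i _ ->]; have [UO TU _ _] := UP i.
  by rewrite /= coord_sum_indicator TU; split=> //; apply: indicator_hull.
have vX i : v i \in <<X>>%VS by rewrite memv_span ?map_f ?mem_enum.
(* Outside [T]: the exchange differs from [b |: ~: T] by the [i]-th unit vector. *)
have outer i : i \notin T -> delta_mx 0 i \in <<X>>%VS.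
  move=> iT; have [_ _ _ /(_ iT)[b bT Ui]] := UP i.
  have [_ _ /(_ bT) Ub _] := UP b.
  have -> : delta_mx 0 i = v b - v i; last exact: rpredB.
  rewrite /v Ub Ui indicatorD1; first by rewrite subKr.
  by rewrite !inE iT orbT.
apply: delta_basis; last by rewrite size_map size_enum_ord.
move=> i; have [iT|] := boolP (i \in T); last exact: outer.
have [_ _ /(_ iT) Ui _] := UP i.
have -> : delta_mx 0 i = v i - indicator_vec R (~: T).
  by rewrite /v Ui !indicator_sum big_setU1 ?addrK // inE iT.
rewrite rpredB // indicator_sum rpred_sum // => j; rewrite inE; exact: outer.
Qed.

(** When [a] has no exchange, [coord_sum T x = x_a] on the whole face; this
equation fails at the [a]-th unit vector, since [a] lies outside [T], so the
face cannot span the space. *)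
Lemma facet_quasi_feasible X : upper_closed Omega -> ~: T \notin Omega ->
  (forall x, x \in X -> hull x /\ coord_sum T x = 1) -> basis_of fullv X ->
  quasi_feasible Omega (~: T).
Proof.
move=> upO SO XP Xb; split; first by rewrite inE.
move=> a; rewrite inE => aT; apply: contrapT => no_swap.
have a_in U : U \in Omega -> #|T :&: U| = 1%N -> a \in U.
  move=> UO /eqP/cards1P[b TUb]; apply/negPn/negP => aU.
  have bT : b \in T by move: (set11 b); rewrite -TUb inE => /andP[].
  apply: no_swap; exists b; first by rewrite setCK.
  apply: upO UO _; apply/subsetP => i iU; rewrite !inE.
  have [iT|] := boolP (i \in T).
    have : i \in T :&: U by rewrite inE iT.
    by rewrite TUb inE => ->; rewrite orbT.
  by rewrite andbT; case: eqP => // ia; rewrite -ia iU in aU.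
(* A feasible set meets [T] at least twice, or meets it once and contains [a]. *)
have lower x : hull x -> 2 <= coord_sum (a |: T) x.
  apply: convex_hull_ge => _ [U UO <-]; rewrite /= coord_sum_indicator ler_nat.
  have TU := feasible_meets upO SO UO.
  rewrite setIUl; have [TU1|TU1] := eqVneq #|T :&: U| 1%N; last first.
    by apply: leq_trans (subset_leq_card (subsetUr _ _)); lia.
  rewrite (setIidPl _) ?sub1set ?a_in // cardsU1 TU1.
  by rewrite inE (negPf aT).
have upper x : hull x -> coord_sum [set a] x <= 1.
  apply: convex_hull_le => _ [U UO <-]; rewrite /= coord_sum_indicator lern1.
  by rewrite -(cards1 a) subset_leq_card // subsetIl.
have vanish : {in X, forall x, (coord_sum T \- coord_sum [set a]) x = 0}.
  move=> x /XP[xP xT]; have := lower x xP; have := upper x xP.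
  rewrite /coord_sum big_setU1 //= big_set1 => h1 h2.
  by move: xT; rewrite /coord_sum; lra.
have [Xfull _] := basis_fullP _ Xb.
have := scalar_span0 vanish (Xfull (indicator_vec R [set a])).
rewrite /= !coord_sum_indicator setIid cards1.
rewrite (_ : T :&: _ = set0) ?cards0; first by lra.
by apply/eqP; rewrite setI_eq0 disjoint_sym disjoints1.
Qed.

End Facet.

Theorem corollary5 (R : realFieldType) (n : nat) (Omega : {set {set 'I_n}})
    (T : {set 'I_n}) :
  upper_closed Omega ->
  (forall T' : {set 'I_n},
      T' \in min_sets (hat_sys (~: Omega)) -> (2 <= #|T'|)%N) ->
  T \in min_sets (hat_sys (~: Omega)) ->
  ~: T \in max_sets (~: Omega) /\
  (facet_defining (convex_hull (indicator_pts R Omega)) (coord_sum T) 1 <->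
   quasi_feasible Omega (~: T)).
Proof.
move=> upO large Tmin; have maxS := min_hat_max Tmin; split=> //.
have SO := max_sets_infeasible maxS.
have n_gt0 : (0 < n)%N.
  by have := leq_trans (large _ Tmin) (max_card _); rewrite card_ord => /ltnW.
have full := hull_full_dim R upO (setC1_feasible large) n_gt0.
rewrite (facet_fullP _ full); split=> [[_ [X XP Xb]]|qf].
  exact: facet_quasi_feasible upO SO XP Xb.
by split; [apply: coord_sum_valid|apply: quasi_feasible_basis].
Qed.
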